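(* Let $R,S\ge 2$ and let $\mathcal{T}=\mathrm{PT2D}(A,B,F,G,H)\in\mathbb{R}^{R\times S\times K}$ with $A\in\mathbb{R}^{R\times R}$, $B\in\mathbb{R}^{S\times S}$, $F\in\mathbb{R}^{R\times S}$, $G\in\mathbb{R}^{R\times K}$, $H\in\mathbb{R}^{S\times K}$. Assume that (i) $\operatorname{rank}A=R$ and $\operatorname{rank}B=S$; (ii) $F$ has no zero entries; (iii) $\operatorname{rank}(G\odot G\odot H\odot H)=\frac{R(R+1)}{2}\cdot\frac{S(S+1)}{2}$. Let $M=\binom{R}{2}\binom{S}{2}$, let $p_1,\ldots,p_M$ be any basis of $\sigma_2(\operatorname{lker}\Phi(\mathcal{T}))$ (which has dimension $M$), and let $P_k=\pi(p_k)\in\mathbb{R}^{R^2\times S^2}$. 1. Let $P_A=\begin{bmatrix}P_1&\cdots&P_M\end{bmatrix}\in\mathbb{R}^{R^2\times S^2M}$. Then $\dim\sigma_2(\operatorname{lker}P_A)=R$ if and only if $\operatorname{krank}(F^{\top})\ge 2$. In that case $$\sigma_2(\operatorname{lker}P_A)=\operatorname{Span}\{a_1\boxtimes a_1,\ldots,a_R\boxtimes a_R\}=\operatorname{range}(A\odot A),$$ where $a_k$ are the columns of $A$. 2. Let $P_B=\begin{bmatrix}P_1^{\top}&\cdots&P_M^{\top}\end{bmatrix}\in\mathbb{R}^{S^2\times R^2M}$. Then $\dim\sigma_2(\operatorname{lker}P_B)=S$ if and only if $\operatorname{krank}(F)\ge 2$. In that case $$\sigma_2(\operatorname{lker}P_B)=\operatorname{Span}\{b_1\boxtimes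 b_1,\ldots,b_S\boxtimes b_S\}=\operatorname{range}(B\odot B),$$ where $b_k$ are the columns of $B$.
   Context: All matrices and tensors are real. $\mathrm{PT2D}(A,B,F,G,H)$ denotes the third-order tensor $\mathcal{T}$ whose frontal slices are $\mathcal{T}_{:,:,k}=A\,\mathrm{Diag}(g_k)\,F\,\mathrm{Diag}(h_k)\,B^{\top}$, $k=1,\ldots,K$, where $g_k,h_k$ are the $k$-th columns of $G,H$. $\mathrm{vec}$ is column-major vectorization, $\boxtimes$ the Kronecker product, $\odot$ the Khatri–Rao (columnwise Kronecker) product, $\otimes$ the outer product; for vectors, $\mathrm{vec}(a\otimes b\otimes y\otimes z)=z\boxtimes y\boxtimes b\boxtimes a$. $\operatorname{krank}(Z)$ is the Kruskal rank: the largest $k$ such that every $k$ columns of $Z$ are linearly independent. $\operatorname{lker}Z=\{v: v^{\top}Z=0\}$. For $\mathcal{T}\in\mathbb{R}^{R\times S\times K}$, $\Phi(\mathcal{T})\in\mathbb{R}^{(RS)^2\times K}$ is the matrix whose $k$-th column is $\mathrm{vec}(\mathcal{T}_{:,:,k})\boxtimes\mathrm{vec}(\mathcal{T}_{:,:,k})$. For any $n$, $\sigma_2:\mathbb{R}^{n^2}\to\mathbb{R}^{n^2}$ is the symmetrization map $\mathrm{vec}(X)\mapsto\mathrm{vec}((X+X^{\top})/2)$, $X\in\mathbb{R}^{n\times n}$; $\sigma_2(\mathcal{V})$ is the image of a subspace $\mathcal{V}$. It is used with $n=RS$ for $\operatorname{lker}\Phi(\mathcal{T})$, $n=R$ for $\operatorname{lker}P_A$,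 $n=S$ for $\operatorname{lker}P_B$. $\pi:\mathbb{R}^{(RS)^2}\to\mathbb{R}^{R^2\times S^2}$ is the linear map (permutation, symmetrization, matricization) determined by $$\pi(\mathrm{vec}(a\otimes b\otimes y\otimes z))=\tfrac12(a\boxtimes y+y\boxtimes a)\cdot\tfrac12(b\boxtimes z+z\boxtimes b)^{\top},\quad a,y\in\mathbb{R}^R,\ b,z\in\mathbb{R}^S.$$ *)

(* Defs.v *)
From HB Require Import structures.
From mathcomp Require Import all_boot all_order all_algebra ring.
From mathcomp Require Export reals mxtens.

Set Implicit Arguments.
Unset Strict Implicit.
Unset Printing Implicit Defensive.

Import Order.TTheory GRing.Theory Num.Theory.
Local Open Scope ring_scope.

(* [tensmx] ([*t]) on columns has type ['M_(m * n, 1 * 1)]; this retypes it as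
   a column. *)
Definition kronv (RR : realType) m n (a : 'cV[RR]_m) (b : 'cV[RR]_n) :
  'cV[RR]_(m * n) := a *t b.

Notation "a ⊠ b" := (kronv a b) (at level 40, left associativity) : ring_scope.

Definition khatri_rao (RR : realType) m p n
    (A : 'M[RR]_(m, n)) (B : 'M[RR]_(p, n)) : 'M[RR]_(m * p, n) :=
  \matrix_(i, j) (col j A ⊠ col j B) i 0.

Notation "A ⊙ B" := (khatri_rao A B) (at level 40, left associativity) :
  ring_scope.

Section Vectorization.
Variable RR : realType.

(* The entry [X i j] of an [m * n] matrix sits at position [j * m + i], so
   the length is written [n * m]; in particular [vec (a *m b^T) = b ⊠ a]. *)
Definition vec m n (X : 'M[RR]_(m, n)) : 'cV[RR]_(n * m) :=
  \col_k X (mxtens_unindex k).2 (mxtens_unindex k).1.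

Definition unvec m n (v : 'cV[RR]_(n * m)) : 'M[RR]_(m, n) :=
  \matrix_(i, j) v (mxtens_index (j, i)) 0.

Lemma vecK m n : cancel (@vec m n) (@unvec m n).
Proof. by move=> X; apply/matrixP=> i j; rewrite !mxE mxtens_indexK. Qed.

Lemma unvecK m n : cancel (@unvec m n) (@vec m n).
Proof.
by move=> v; apply/colP=> k; rewrite !mxE -surjective_pairing mxtens_unindexK.
Qed.

Lemma kronvE m n (a : 'cV[RR]_m) (b : 'cV[RR]_n) i j :
  (a ⊠ b) (mxtens_index (i, j)) 0 = a i 0 * b j 0.
Proof. by rewrite !mxE mxtens_indexK; congr (a _ _ * b _ _); apply: ord1. Qed.

Lemma vec_outer m n (a : 'cV[RR]_m) (b : 'cV[RR]_n) :
  vec (a *m b^T) = b ⊠ a.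
Proof.
apply/colP=> k; case: (mxtens_indexP k) => j i.
by rewrite kronvE !mxE mxtens_indexK big_ord1 !mxE mulrC.
Qed.

Definition sym2 n (v : 'cV[RR]_(n * n)) : 'cV[RR]_(n * n) :=
  vec (2^-1 *: (unvec v + (unvec v)^T)).

Lemma sym2_vec n (X : 'M[RR]_n) : sym2 (vec X) = vec (2^-1 *: (X + X^T)).
Proof. by rewrite /sym2 vecK. Qed.

Fact sym2_is_linear n : linear (@sym2 n).
Proof.
move=> c u v; apply/colP=> k; rewrite !mxE; ring.
Qed.

HB.instance Definition _ n :=
  GRing.isLinear.Build RR _ _ _ (@sym2 n) (@sym2_is_linear n).

Definition sigma2 n : 'End('cV[RR]_(n * n)) := linfun (@sym2 n).

(* The entries of [p] are indexed by [((s2, r2), (s1, r1))]; lemmas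
   [pi_mx_outer] and [pi_mx_unique] show that this is the linear map with the
   prescribed values on rank-one tensors. *)
Definition pi_mx R S (p : 'cV[RR]_((S * R) * (S * R))) :
    'M[RR]_(R * R, S * S) :=
  let e r1 s1 r2 s2 :=
    p (mxtens_index (mxtens_index (s2, r2), mxtens_index (s1, r1))) 0 in
  \matrix_(i, j)
    let: (r, r') := mxtens_unindex i in
    let: (s, s') := mxtens_unindex j in
    4^-1 * (e r s r' s' + e r s' r' s + e r' s r s' + e r' s' r s).

Fact pi_mx_is_linear R S : linear (@pi_mx R S).
Proof.
move=> c u v; apply/matrixP=> i j.
have E k : (c *: u + v) k 0 = c * u k 0 + v k 0 by rewrite !mxE.
rewrite !mxE /= !E; ring.
Qed.

HB.instance Definition _ R S :=
  GRing.isLinear.Build RR _ _ _ (@pi_mx R S) (@pi_mx_is_linear R S).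

(* [vec (a ⊗ b ⊗ y ⊗ z)], parenthesized so that its length is syntactically
   [(S * R) * (S * R)]. *)
Definition vec_outer4 R S (a : 'cV[RR]_R) (b : 'cV[RR]_S)
    (y : 'cV[RR]_R) (z : 'cV[RR]_S) : 'cV[RR]_((S * R) * (S * R)) :=
  (z ⊠ y) ⊠ (b ⊠ a).

Lemma pi_mx_outer R S (a : 'cV[RR]_R) (b : 'cV[RR]_S)
    (y : 'cV[RR]_R) (z : 'cV[RR]_S) :
  pi_mx (vec_outer4 a b y z) =
  (2^-1 *: (a ⊠ y + y ⊠ a)) *m (2^-1 *: (b ⊠ z + z ⊠ b))^T.
Proof.
apply/matrixP=> i j; case: (mxtens_indexP i) => r r'.
case: (mxtens_indexP j) => s s'.
rewrite mxE !mxtens_indexK !kronvE mxE big_ord1.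
rewrite [in RHS]mxE [in X in _ = _ * X]mxE [in X in _ = _ * X]mxE.
rewrite [X in _ = _ * X * _]mxE [X in _ = _ * (_ * X)]mxE !kronvE.
by field.
Qed.

Lemma vec_delta m n (v : 'cV[RR]_(m * n)) :
  v = \sum_i \sum_j v (mxtens_index (i, j)) 0 *:
        (delta_mx i 0 ⊠ delta_mx j 0).
Proof.
apply/colP=> k; case: (mxtens_indexP k) => i j.
rewrite summxE (bigD1 i) //= summxE (bigD1 j) //= mxE kronvE !mxE !eqxx.
rewrite !mulr1 big1 => [|j' /negPf nj]; last first.
  by rewrite mxE kronvE !mxE [j == _]eq_sym nj !(andbT, mulr0).
rewrite addr0 big1 ?addr0 // => i' /negPf ni; rewrite summxE big1 // => j' _.
by rewrite mxE kronvE !mxE [i == _]eq_sym ni /= mul0r mulr0.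
Qed.

Lemma pi_mx_unique R S (f : {linear 'cV[RR]_((S * R) * (S * R)) ->
    'M[RR]_(R * R, S * S)}) :
  (forall a b y z, f (vec_outer4 a b y z) =
     (2^-1 *: (a ⊠ y + y ⊠ a)) *m (2^-1 *: (b ⊠ z + z ⊠ b))^T) ->
  f =1 @pi_mx R S.
Proof.
move=> fE p; rewrite [p]vec_delta !linear_sum; apply: eq_bigr => k2 _.
rewrite !linear_sum; apply: eq_bigr => k1 _; rewrite !linearZ; congr (_ *: _).
have dE k : (delta_mx k 0 : 'cV[RR]_(S * R)) =
    delta_mx (mxtens_unindex k).1 0 ⊠ delta_mx (mxtens_unindex k).2 0.
  apply/colP=> l; case: (mxtens_indexP l) => s r; case: (mxtens_indexP k) => s' r'.
  rewrite mxtens_indexK kronvE !mxE !andbT -natrM mulnb.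
  by rewrite (can_eq (@mxtens_indexK S R)).
by rewrite !dE; exact: etrans (fE _ _ _ _) (esym (pi_mx_outer _ _ _ _)).
Qed.

End Vectorization.

Section ColumnSpaces.
Variable RR : realType.

Definition left_ker m n (Z : 'M[RR]_(m, n)) : {vspace 'cV[RR]_m} :=
  lker (linfun (mulmx Z^T) : 'Hom('cV[RR]_m, 'cV[RR]_n)).

Lemma mem_left_ker m n (Z : 'M[RR]_(m, n)) (v : 'cV[RR]_m) :
  (v \in left_ker Z) = (v^T *m Z == 0).
Proof. by rewrite memv_ker lfunE /= -trmx_eq0 trmx_mul trmxK. Qed.

Definition range_mx m n (Z : 'M[RR]_(m, n)) : {vspace 'cV[RR]_m} :=
  limg (linfun (mulmx Z) : 'Hom('cV[RR]_n, 'cV[RR]_m)).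

(* The bound [k <= n] matters: for [k > n] the condition holds vacuously. *)
Definition krank m n (Z : 'M[RR]_(m, n)) : nat :=
  \max_(k < n.+1 | [forall J : {set 'I_n},
      (#|J| == k) ==> free [seq col j Z | j in J]]) k.

End ColumnSpaces.

Section Tensors.
Variable RR : realType.

(* An R x S x K tensor is given by its frontal slices. *)
Definition tensor R S K := 'I_K -> 'M[RR]_(R, S).

Definition PT2D R S K (A : 'M[RR]_R) (B : 'M[RR]_S) (F : 'M[RR]_(R, S))
    (G : 'M[RR]_(R, K)) (H : 'M[RR]_(S, K)) : tensor R S K :=
  fun k => A *m diag_mx (col k G)^T *m F *m diag_mx (col k H)^T *m B^T.

Definition Phi R S K (T : tensor R S K) : 'M[RR]_((S * R) * (S * R), K) :=
  \matrix_(i, k) (vec (T k) ⊠ vec (T k)) i 0.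

End Tensors.

(* Main.v *)
Require Import Defs.
From mathcomp Require Import all_boot all_order all_algebra ring.

Set Implicit Arguments.
Unset Strict Implicit.
Unset Printing Implicit Defensive.

Import Order.TTheory GRing.Theory Num.Theory.
Local Open Scope ring_scope.

(** Why the theorem holds. A vector [p] of [V] is a quadratic form on R x S
    matrices that vanishes on the slices [A *m Y *m B^T], where
    [Y i j = g i * F i j * h j] for the columns [g], [h] of [G], [H]. Since [A]
    and [B] are invertible, substituting [X = A *m Y *m B^T] reduces everything to
    [A = 1], [B = 1] ([pi_mx_factor], [mem_sigma2_left_ker_Phi]).

    Let [c] be the coefficients of the form in [Y]. The products
    [g i * g i' * h j * h j'] span the tensors symmetric in both pairs of indices,
    because the assumed rank is the dimension of that space
    ([bisym_orthogonal_eq0]). So the form vanishes on all [Y] iff, for all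
    [i, i', j, j'],
    [c i j i' j' * F i j * F i' j' + c i j' i' j * F i j' * F i' j = 0]
    ([swap_relationP]). As [F] has no zero entry, this leaves one free parameter
    for each choice of [i < i'] and [j < j'], whence the dimension of [V]
    ([dim_slice_forms]).

    The map [pi_mx] averages [c i j i' j'] and [c i j' i' j], which multiplies the
    free parameter by a multiple of the 2 x 2 minor of [F] on rows [i, i'] and
    columns [j, j']. The image of [V] is therefore the space of all matrices with
    the symmetries of [pi_mx] that are supported on the nonzero minors
    ([pi_slice_form], [pi_slice_form_onto]). A symmetric tensor [x] is in the left
    kernel of all of them iff [x i i' = 0] as soon as some minor on the rows
    [i, i'] is nonzero. Hence [VA] is the span of the [a_i ⊠ a_i], of dimension
    [R], and of one more direction for each pair of parallel rows of [F]
    ([mem_sigma2_left_ker], [sigma2_left_kerE], [dim_sigma2_left_ker]). That there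
    is no such pair is the condition on the Kruskal rank ([krank_tr_ge2]). The
    statement on [VB] is the one on [VA] for the transposed matrices. *)

(** * Kronecker products and symmetrization in coordinates *)

Section Kronecker.
Variable RR : realType.

Lemma sum_mxtens m n (f : 'I_(m * n) -> RR) :
  \sum_k f k = \sum_i \sum_j f (mxtens_index (i, j)).
Proof.
rewrite pair_big (reindex (@mxtens_index m n)) /=; last first.
  by exists (@mxtens_unindex m n) => k _;
    rewrite ?mxtens_indexK ?mxtens_unindexK.
by apply: eq_bigr => -[].
Qed.

Lemma tens_kronv m n p q (X : 'M[RR]_(m, n)) (Y : 'M[RR]_(p, q)) a b :
  (X *t Y) *m (a ⊠ b) = (X *m a) ⊠ (Y *m b).
Proof. exact: (tensmx_mul X Y a b). Qed.

Lemma tens_unitmx m n (X : 'M[RR]_m) (Y : 'M[RR]_n) :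
  X \in unitmx -> Y \in unitmx -> X *t Y \in unitmx.
Proof.
move=> uX uY; suff : (invmx X *t invmx Y) *m (X *t Y) = 1%:M.
  by case/mulmx1_unit.
rewrite tensmx_mul !mulVmx //; apply/matrixP => k l.
case: (mxtens_indexP k) => i j; case: (mxtens_indexP l) => i' j'.
rewrite tensmxE !mxE -natrM mulnb.
by rewrite (can_eq (@mxtens_indexK m n)).
Qed.

Lemma vec_mul m n p q (X : 'M[RR]_(p, m)) (Z : 'M[RR]_(m, n))
    (Y : 'M[RR]_(q, n)) :
  vec (X *m Z *m Y^T) = (Y *t X) *m vec Z.
Proof.
apply/colP => k; case: (mxtens_indexP k) => j i.
rewrite !mxE mxtens_indexK /= sum_mxtens; apply: eq_bigr => l _.
rewrite mxE mulr_suml; apply: eq_bigr => h _.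
by rewrite tensmxE !mxE mxtens_indexK /=; ring.
Qed.

Lemma sym2E n (v : 'cV[RR]_(n * n)) i j :
  sym2 v (mxtens_index (i, j)) 0 =
  2^-1 * (v (mxtens_index (i, j)) 0 + v (mxtens_index (j, i)) 0).
Proof. by rewrite !mxE mxtens_indexK. Qed.

Lemma sym2_tens m n (X : 'M[RR]_(m, n)) v :
  sym2 ((X *t X) *m v) = (X *t X) *m sym2 v.
Proof.
rewrite -[v]unvecK -vec_mul !sym2_vec -vec_mul.
by rewrite -scalemxAr -scalemxAl mulmxDr mulmxDl !trmx_mul trmxK mulmxA.
Qed.

Lemma sym2P n (v : 'cV[RR]_(n * n)) :
  sym2 v = v <->
  forall i j, v (mxtens_index (i, j)) 0 = v (mxtens_index (j, i)) 0.
Proof.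
split=> [<- i j | vC]; first by rewrite !sym2E addrC.
apply/colP => k; case: (mxtens_indexP k) => i j.
by rewrite sym2E -(vC i j); field.
Qed.

Lemma sym2_id n (v : 'cV[RR]_(n * n)) : sym2 (sym2 v) = sym2 v.
Proof. by apply/sym2P => i j; rewrite !sym2E addrC. Qed.

(** The columns of [A ⊙ A] are the images under [A *t A] of the diagonal
    tensors, so a statement about [A] invertible reduces to [A = 1]. *)
Lemma khatri_rao_tens n p (A : 'M[RR]_(n, p)) :
  A ⊙ A = (A *t A) *m (1%:M ⊙ 1%:M).
Proof.
apply/matrixP => k j; rewrite mxE [RHS]mxE.
rewrite [col j A]colE -tens_kronv [LHS]mxE; apply: eq_bigr => l _.
by congr (_ * _); rewrite [RHS]mxE [col j 1%:M]colE mul1mx.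
Qed.

Lemma diag_tensE n (u : 'cV[RR]_n) i j :
  (((1%:M : 'M_n) ⊙ 1%:M) *m u) (mxtens_index (i, j)) 0 = (i == j)%:R * u i 0.
Proof.
rewrite mxE (bigD1 i) //= big1 ?addr0 => [|l /negPf nli].
  by rewrite mxE kronvE !mxE eqxx mul1r [j == i]eq_sym.
by rewrite mxE kronvE !mxE [i == l]eq_sym nli !mul0r.
Qed.

Lemma mem_range_mx m n (Z : 'M[RR]_(m, n)) y :
  (y \in range_mx Z) <-> exists u, y = Z *m u.
Proof.
split=> [/memv_imgP[u _ ->] | [u ->]]; first by exists u; rewrite lfunE.
by apply/memv_imgP; exists u; rewrite ?memvf ?lfunE.
Qed.

Lemma span_khatri_rao m n (A : 'M[RR]_(m, n)) :
  <<[seq col k A ⊠ col k A | k : 'I_n]>>%VS = range_mx (A ⊙ A).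
Proof.
have colAA k : col k A ⊠ col k A = (A ⊙ A) *m delta_mx k 0.
  by rewrite -colE; apply/colP => l; rewrite !mxE.
apply/eqP; rewrite eqEsubv; apply/andP; split.
  apply/span_subvP => _ /imageP[k _ ->]; apply/mem_range_mx.
  by exists (delta_mx k 0).
apply/subvP => _ /mem_range_mx[u ->].
have -> : u = \sum_k u k 0 *: delta_mx k 0.
  by rewrite {1}[u]matrix_sum_delta; apply: eq_bigr => k _; rewrite big_ord1.
rewrite mulmx_sumr memv_suml // => k _; rewrite -scalemxAr -colAA memvZ //.
by apply/memv_span/imageP; exists k.
Qed.

Lemma dim_range_khatri_rao n (A : 'M[RR]_n) :
  A \in unitmx -> \dim (range_mx (A ⊙ A)) = n.
Proof.
move=> uA; rewrite /range_mx limg_dim_eq; first by rewrite dimvf /dim /= muln1.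
rewrite capfv; apply/eqP/lker0P => u v; rewrite !lfunE /= khatri_rao_tens.
rewrite -!mulmxA => /(can_inj (mulKmx (tens_unitmx uA uA))) uv.
apply/colP => i.
have := congr1 (fun w : 'cV_(n * n) => w (mxtens_index (i, i)) 0) uv.
by rewrite !diag_tensE eqxx !mul1r.
Qed.

Lemma mem_left_ker_mxrow m n M (P : 'I_M -> 'M[RR]_(m, n)) v :
  (v \in left_ker (\mxrow_(k < M) P k)) <-> forall k, v^T *m P k = 0.
Proof.
rewrite mem_left_ker mul_mxrow; split=> [/eqP v0 k | v0].
  have /eq_mxrowP -> // : \mxrow_k (v^T *m P k) = \mxrow_k (0 : 'M[RR]_(1, n)).
  rewrite v0; apply/mxrowP => i; rewrite mxrowK.
  by apply/matrixP => a b; rewrite !mxE.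
apply/eqP/mxrowP => i; rewrite mxrowK v0.
by apply/matrixP => a b; rewrite !mxE.
Qed.

End Kronecker.

(** * The left kernel of matrices supported on the 2 x 2 minors *)

Section Minors.
Variable RR : realType.

Definition minor2 m n (F : 'M[RR]_(m, n)) i i' j j' :=
  F i j * F i' j' - F i j' * F i' j.

(** For [F] without zero entries these are exactly the matrices [pi_mx c] for
    [c] ranging over the coefficients of the forms that vanish on the slices.
    Transposition exchanges this set with its analogue for [F^T], which makes the
    two halves of the theorem one statement. *)
Definition minor_supported m n (F : 'M[RR]_(m, n)) (Q : 'M[RR]_(m * m, n * n)) :=
  forall i i' j j',
    let q a b c d := Q (mxtens_index (a, b)) (mxtens_index (c, d)) in
    [/\ q i i' j j' = q i' i j j', q i i' j j' = q i i' j' j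
      & minor2 F i i' j j' = 0 -> q i i' j j' = 0].

Lemma minor_supported_tr m n (F : 'M[RR]_(m, n)) Q :
  minor_supported F Q -> minor_supported F^T Q^T.
Proof.
move=> FQ j j' i i' /=; have [q1 q2 q0] := FQ i i' j j'.
by split; rewrite !mxE // => F0; apply: q0; rewrite -F0 /minor2 !mxE; ring.
Qed.

(** This matrix witnesses that no coordinate with a nonzero minor is forced to
    vanish. *)
Definition minor_indicator m n (F : 'M[RR]_(m, n)) : 'M[RR]_(m * m, n * n) :=
  \matrix_(k, l) (minor2 F (mxtens_unindex k).1 (mxtens_unindex k).2
    (mxtens_unindex l).1 (mxtens_unindex l).2 != 0)%:R.

Lemma minor_indicatorP m n (F : 'M[RR]_(m, n)) :
  minor_supported F (minor_indicator F).
Proof.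
have minorN i i' j j' : minor2 F i' i j j' = - minor2 F i i' j j'.
  by rewrite /minor2; ring.
have minorNr i i' j j' : minor2 F i i' j' j = - minor2 F i i' j j'.
  by rewrite /minor2; ring.
move=> i i' j j'; rewrite /= !mxE !mxtens_indexK /=.
rewrite (minorN i i') (minorNr i i' j) !oppr_eq0.
by split=> // ->; rewrite eqxx.
Qed.

(** The condition on [(i, i')] is empty when rows [i] and [i'] of [F] are
    parallel; this includes [i = i']. *)
Definition skew_off_parallel m n (F : 'M[RR]_(m, n)) (x : 'cV[RR]_(m * m)) :=
  forall i i' j j', minor2 F i i' j j' != 0 ->
    x (mxtens_index (i, i')) 0 + x (mxtens_index (i', i)) 0 = 0.

(** By the symmetry of [Q] in its row indices, [x^T *m Q] only involves the sums
    of [x] over the orbits [(i, i'), (i', i)]; the entries of [Q] on distinct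
    orbits with nonzero minors are independent. *)
Lemma annihilate_minor_supported m n (F : 'M[RR]_(m, n)) (x : 'cV[RR]_(m * m)) :
  (forall Q, minor_supported F Q -> x^T *m Q = 0) <-> skew_off_parallel F x.
Proof.
have xQE Q (j j' : 'I_n) : minor_supported F Q ->
    (x^T *m Q) 0 (mxtens_index (j, j')) = 2^-1 * \sum_i \sum_i'
      (x (mxtens_index (i, i')) 0 + x (mxtens_index (i', i)) 0)
        * Q (mxtens_index (i, i')) (mxtens_index (j, j')).
  move=> FQ; pose f i i' := x (mxtens_index (i, i')) 0
    * Q (mxtens_index (i, i')) (mxtens_index (j, j')).
  have -> : (x^T *m Q) 0 (mxtens_index (j, j')) = \sum_i \sum_i' f i i'.
    rewrite mxE sum_mxtens; apply: eq_bigr => i _.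
    by apply: eq_bigr => i' _; rewrite mxE.
  have -> : \sum_i \sum_i' (x (mxtens_index (i, i')) 0
       + x (mxtens_index (i', i)) 0) * Q (mxtens_index (i, i')) (mxtens_index (j, j'))
     = \sum_i \sum_i' f i i' + \sum_i \sum_i' f i' i.
    rewrite -big_split; apply: eq_bigr => i _; rewrite -big_split.
    apply: eq_bigr => i' _; rewrite /f /= mulrDl.
    by have [/= -> _ _] := FQ i i' j j'.
  by rewrite [X in _ + X]exchange_big /=; field.
split=> [xQ i i' j j' F0 | xF Q FQ]; last first.
  apply/matrixP => o k; rewrite ord1; case: (mxtens_indexP k) => j j'.
  rewrite xQE // !mxE big1 ?mulr0 // => i _; rewrite big1 // => i' _.
  have [/eqP F0 | F0] := boolP (minor2 F i i' j j' == 0).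
    by have [_ _ ->] := FQ i i' j j'; rewrite ?mulr0.
  by rewrite (xF _ _ _ _ F0) mul0r.
(* Supporting the indicator on the rows (i, i') and (i', i) isolates one
   condition. *)
pose d a a' : 'cV[RR]_(m * m) := delta_mx (mxtens_index (a, a')) 0.
pose s := d i i' + d i' i.
have dC a a' b b' : d a a' (mxtens_index (b', b)) 0 = d a' a (mxtens_index (b, b')) 0.
  rewrite !mxE !(can_eq (@mxtens_indexK m m)) !xpair_eqE.
  by rewrite [(b' == a) && _]andbC.
have sC a a' : s (mxtens_index (a', a)) 0 = s (mxtens_index (a, a')) 0.
  by rewrite ![s _ _]mxE !(dC _ _ a a') addrC.
pose Q : 'M[RR]_(m * m, n * n) := \matrix_(k, l) (s k 0 * minor_indicator F k l).
have QE k l : Q k l = s k 0 * minor_indicator F k l by rewrite mxE.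
have FQ : minor_supported F Q.
  move=> a a' b b' /=; have [/= q1 q2 q0] := minor_indicatorP F a a' b b'.
  split; rewrite !QE; [by rewrite sC q1 | by rewrite q2 |].
  by move=> F00; rewrite q0 ?mulr0.
have := congr1 (fun v : 'rV_(n * n) => v 0 (mxtens_index (j, j'))) (xQ Q FQ).
have ind a a' : minor2 F a a' j j' != 0 ->
    minor_indicator F (mxtens_index (a, a')) (mxtens_index (j, j')) = 1.
  by move=> F1; rewrite mxE !mxtens_indexK F1.
have F1 : minor2 F i' i j j' != 0.
  by rewrite /minor2 -oppr_eq0; move: F0; rewrite /minor2; congr (_ != _); ring.
have dotd a a' (w : 'I_(m * m) -> RR) :
    \sum_k w k * d a a' k 0 = w (mxtens_index (a, a')).
  rewrite (bigD1 (mxtens_index (a, a'))) //= mxE !eqxx mulr1 big1 ?addr0 //.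
  by move=> k /negPf nk; rewrite mxE nk mulr0.
rewrite [RHS]mxE => <-; rewrite mxE.
under eq_bigr => k _ do rewrite mxE QE mulrCA [s k 0]mxE mulrDl
  ![d _ _ k 0 * _]mulrC.
by rewrite big_split /= !dotd !ind // !mulr1.
Qed.

End Minors.

(** * Recovering one factor *)

Section OneFactor.
Variables (RR : realType) (m n M : nat).
Variables (A : 'M[RR]_m) (B : 'M[RR]_n) (F : 'M[RR]_(m, n)).
Variable P : 'I_M -> 'M[RR]_(m * m, n * n).
Hypotheses (uA : A \in unitmx) (uB : B \in unitmx).
Hypothesis P_supp :
  forall k, minor_supported F ((A *t A)^T *m P k *m (B *t B)).
Hypothesis P_full : forall Q, minor_supported F Q ->
  exists x : 'I_M -> RR, (A *t A)^T *m (\sum_k x k *: P k) *m (B *t B) = Q.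

(* By the two hypotheses, in the coordinates given by [A] and [B] the [P k]
   span exactly the matrices supported on the minors of [F]. *)
Let V := (sigma2 RR m @: left_ker (\mxrow_(k < M) P k))%VS.

Lemma mem_left_ker_tens x :
  ((A *t A) *m x \in left_ker (\mxrow_(k < M) P k)) <-> skew_off_parallel F x.
Proof.
have trE (N : 'M[RR]_(m * m, n * n)) :
    ((A *t A) *m x)^T *m N *m (B *t B) = x^T *m ((A *t A)^T *m N *m (B *t B)).
  by rewrite trmx_mul !mulmxA.
rewrite -annihilate_minor_supported mem_left_ker_mxrow.
split=> [x0 Q /P_full[z <-] | x0 k].
  rewrite -trE mulmx_sumr big1 ?mul0mx // => k _.
  by rewrite -scalemxAr x0 scaler0.
apply: (can_inj (mulmxK (tens_unitmx uB uB))).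
by rewrite mul0mx trE x0.
Qed.

(** The orthogonality conditions leave the antisymmetric part of [x] free, and
    [sym2] then discards it: what remains is the diagonal together with the pairs
    of parallel rows. *)
Lemma mem_sigma2_left_ker y :
  y \in V <-> exists2 x, skew_off_parallel F x & y = (A *t A) *m sym2 x.
Proof.
have uAA := tens_unitmx uA uA; split=> [/memv_imgP[z zP ->] | [x xF ->]].
  exists (invmx (A *t A) *m z); last by rewrite lfunE /= -sym2_tens mulKVmx.
  by apply/mem_left_ker_tens; rewrite mulKVmx.
apply/memv_imgP; exists ((A *t A) *m x); first exact/mem_left_ker_tens.
by rewrite lfunE /= sym2_tens.
Qed.

Definition no_parallel_rows :=
  forall i i', i != i' -> exists j j', minor2 F i i' j j' != 0.

Lemma range_sub_sigma2 : (range_mx (A ⊙ A) <= V)%VS.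
Proof.
apply/subvP => y /mem_range_mx[u ->]; apply/mem_sigma2_left_ker.
exists ((1%:M ⊙ 1%:M) *m u); last first.
  rewrite khatri_rao_tens -mulmxA; congr (_ *m _); symmetry; apply/sym2P => i j.
  by rewrite !diag_tensE eq_sym; case: eqP => [->|]; rewrite ?mul0r.
move=> i i' j j' F0; rewrite !diag_tensE [i' == i]eq_sym.
suff /negPf -> : i != i' by rewrite !mul0r addr0.
by apply: contraNneq F0 => ->; rewrite /minor2 subr_eq0 mulrC.
Qed.

Lemma sigma2_left_kerE : no_parallel_rows -> V = range_mx (A ⊙ A).
Proof.
move=> F1; apply/eqP; rewrite eqEsubv range_sub_sigma2 andbT.
apply/subvP => _ /mem_sigma2_left_ker[x xF ->]; apply/mem_range_mx.
exists (\col_i x (mxtens_index (i, i)) 0).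
rewrite khatri_rao_tens -mulmxA; congr (_ *m _).
apply/colP => k; case: (mxtens_indexP k) => i i'.
rewrite diag_tensE sym2E mxE; case: eqVneq => [<- | ii'].
  by rewrite mul1r; field.
by have [j [j' /xF ->]] := F1 _ _ ii'; rewrite mulr0 mul0r.
Qed.

(** If two rows are parallel, nothing constrains the corresponding off-diagonal
    coordinate, so [V] strictly contains the [m]-dimensional range. *)
Lemma dim_sigma2_left_ker : \dim V = m <-> no_parallel_rows.
Proof.
split=> [dimV i i' ii' | /sigma2_left_kerE ->]; last exact: dim_range_khatri_rao.
have VE : V = range_mx (A ⊙ A).
  symmetry; apply/eqP.
  by rewrite eqEdim range_sub_sigma2 dimV dim_range_khatri_rao ?leqnn.
have [/existsP[j /existsP[j' F0]] | /existsPn F0] :=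
  boolP [exists j, exists j', minor2 F i i' j j' != 0]; first by exists j, j'.
(* [sym2 x] is a symmetric tensor with a nonzero off-diagonal entry. *)
pose x : 'cV[RR]_(m * m) := delta_mx (mxtens_index (i, i')) 0.
have xE a b : x (mxtens_index (a, b)) 0 = ((a == i) && (b == i'))%:R.
  by rewrite mxE (can_eq (@mxtens_indexK m m)) xpair_eqE andbT.
have xF : skew_off_parallel F x.
  have {}F0 j j' : minor2 F i i' j j' = 0.
    by apply/eqP; move/(_ j): F0 => /existsPn/(_ j')/negPn.
  move=> a b j j'; rewrite !xE.
  have [/andP[/eqP-> /eqP->] | _] := boolP ((a == i) && (b == i')).
    by rewrite F0 eqxx.
  have [/andP[/eqP-> /eqP->] | _] := boolP ((b == i) && (a == i')).
    by move: (F0 j j'); rewrite /minor2 => F1 /eqP[]; rewrite -[RHS]oppr0 -F1; ring.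
  by rewrite addr0.
have : (A *t A) *m sym2 x \in V by apply/mem_sigma2_left_ker; exists x.
rewrite VE => /mem_range_mx[u]; rewrite khatri_rao_tens -mulmxA.
move/(can_inj (mulKmx (tens_unitmx uA uA))).
move/(congr1 (fun v : 'cV_(m * m) => v (mxtens_index (i, i')) 0)).
rewrite diag_tensE (negPf ii') mul0r sym2E !xE !eqxx [i' == i]eq_sym (negPf ii') /=.
by rewrite addr0 mulr1 => /eqP; rewrite invr_eq0 pnatr_eq0.
Qed.

End OneFactor.

(** * Kruskal rank at least two *)

Section KruskalRank.
Variable RR : realType.

Lemma subset_of_card (T : finType) (J : {set T}) k :
  (#|J| <= k <= #|T|)%N -> exists2 J' : {set T}, J \subset J' & #|J'| = k.
Proof.
move=> /andP[Jk]; rewrite -(subnKC Jk); move: (k - #|J|)%N => {Jk}k.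
elim: k => [|k IHk] kT; first by exists J; rewrite ?addn0.
have [J' JJ' cJ'] := IHk (leq_trans (leq_add (leqnn _) (leqnSn k)) kT).
have /set0Pn[x xJ'] : ~: J' != set0.
  by rewrite -card_gt0 cardsCs setCK subn_gt0 cJ' (leq_trans _ kT) // addnS.
exists (x |: J'); first by rewrite (subset_trans JJ') ?subsetUr.
by rewrite cardsU1 -in_setC xJ' cJ' addnS.
Qed.

Lemma free_pair (U : vectType RR) (u v : U) :
  u != 0 -> v != 0 -> free [:: u; v] <-> forall c, u <> c *: v.
Proof.
move=> u0 v0; rewrite free_cons span_seq1 seq1_free v0 andbT.
split=> [/vlineP nuv c uv | nuv]; first by apply: nuv; exists c.
by apply/vlineP => -[c]; exact: nuv.
Qed.

Lemma krank_ge2 m n (Z : 'M[RR]_(m, n)) :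
  (2 <= n)%N ->
  (2 <= krank Z)%N <-> forall i i', i != i' -> free [:: col i Z; col i' Z].
Proof.
move=> n2; split=> [Z2 i i' ii' | freeZ].
  pose C (k : 'I_n.+1) := [forall J : {set 'I_n},
    (#|J| == k) ==> free [seq col j Z | j in J]].
  have [k /forallP freek k2] : exists2 k, C k & (2 <= k)%N.
    have [/existsP[k /andP[]] | noC] := boolP [exists k, C k && (2 <= k)%N].
      by exists k.
    suff : (krank Z <= 1)%N by rewrite leqNgt Z2.
    apply/bigmax_leqP => k Ck; rewrite leqNgt; apply/negP => k2.
    by case/negP: (existsPn noC k); apply/andP.
  (* The maximum [k] may exceed 2: a pair is completed to a [k]-element set of
     columns, which is free. *)
  have [| J sJ cJ] := @subset_of_card _ [set i; i'] k.
    by rewrite cards2 ii' k2 card_ord -ltnS ltn_ord.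
  have := freek J; rewrite cJ eqxx /= => freeJ.
  have eJ : perm_eq (enum J) ([:: i; i'] ++ enum (J :\: [set i; i'])).
    apply: uniq_perm; rewrite ?enum_uniq // ?cat_uniq ?enum_uniq /=.
      rewrite inE ii' !andbT /=; apply/hasPn => j.
      by rewrite mem_enum !inE => /andP[].
    move=> j; rewrite !in_cons !mem_enum !inE.
    have [/eqP -> | _] := boolP (j == i); first by rewrite (subsetP sJ) ?inE ?eqxx.
    have [/eqP -> | //] := boolP (j == i').
    by rewrite (subsetP sJ) ?inE ?eqxx ?orbT.
  move: freeJ; rewrite (perm_free (perm_map _ eJ)) map_cat.
  exact: catl_free.
have n3 : (2 < n.+1)%N by [].
apply: (bigop.bigmax_sup (Ordinal n3)) => //=.
apply/forallP => J; apply/implyP => /cards2P[i [i' [ii' ->]]].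
have eJ : perm_eq (enum [set i; i']) [:: i; i'].
  apply: uniq_perm; rewrite ?enum_uniq //= ?inE ?ii' // => j.
  by rewrite mem_enum !inE.
by rewrite (perm_free (perm_map _ eJ)) freeZ.
Qed.

(** As [F] has no zero row, two rows are dependent exactly when one is a multiple
    of the other, that is, when all their 2 x 2 minors vanish. *)
Lemma krank_tr_ge2 m n (F : 'M[RR]_(m, n)) :
  (2 <= m)%N -> (0 < n)%N -> (forall i j, F i j != 0) ->
  (2 <= krank F^T)%N <-> no_parallel_rows F.
Proof.
move=> m2 n0 F0; rewrite (krank_ge2 _ m2).
pose j0 := Ordinal n0.
have row0 i : col i F^T != 0.
  apply/eqP => /colP/(_ j0)/eqP; rewrite !mxE; exact/negP.
split=> [freeF i i' ii' | F1 i i' ii'].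
  have /(free_pair (row0 i) (row0 i')) nprop := freeF _ _ ii'.
  have [/existsP[j /existsP[j' F00]] | /existsPn F00] :=
    boolP [exists j, exists j', minor2 F i i' j j' != 0]; first by exists j, j'.
  case: (nprop (F i j0 / F i' j0)); apply/colP => j; rewrite !mxE.
  move/existsPn/(_ j)/negPn: (F00 j0); rewrite subr_eq0 => /eqP FE.
  by rewrite mulrAC FE mulfK.
apply/(free_pair (row0 i) (row0 i')) => c /colP cE.
have FE j : F i j = c * F i' j by have := cE j; rewrite !mxE.
have [j [j' /eqP[]]] := F1 _ _ ii'; rewrite /minor2 !FE; ring.
Qed.

End KruskalRank.

(** * Counting pairs *)

Section Counting.

Lemma card_pairs n (r : rel nat) (f : nat -> nat) :
  (forall j, j < n -> \sum_(i < n | r i j) 1 = f j)%N ->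
  #|[set a : 'I_n * 'I_n | r a.1 a.2]| = (\sum_(j < n) f j)%N.
Proof.
move=> fE; rewrite -sum1dep_card.
rewrite -(pair_big_dep xpredT (fun i j : 'I_n => r i j) (fun _ _ => 1%N)) /=.
rewrite (exchange_big_dep xpredT) //=.
by apply: eq_bigr => j _; rewrite fE.
Qed.

Lemma card_ltn_pairs n : #|[set a : 'I_n * 'I_n | a.1 < a.2]%N| = 'C(n, 2).
Proof.
rewrite (@card_pairs _ (fun i j => i < j)%N id) => [|j jn].
  by rewrite -bin2_sum big_mkord.
by rewrite -(big_ord_widen _ (fun _ => 1%N) (ltnW jn)) sum1_card card_ord.
Qed.

Lemma card_leq_pairs n :
  #|[set a : 'I_n * 'I_n | a.1 <= a.2]%N| = (n * (n + 1) %/ 2)%N.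
Proof.
rewrite (@card_pairs _ (fun i j => i <= j)%N S) => [|j jn].
  rewrite addn1 mulnC divn2 -[n in (_ * n)%N]/(n.+1.-1) -bin2 -bin2_sum.
  by rewrite big_mkord big_ord_recl add0n.
by rewrite -(big_ord_widen _ (fun _ => 1%N) jn) sum1_card card_ord.
Qed.

Lemma card_pair_product m n (r : rel nat) :
  #|[set q : ('I_m * 'I_m) * ('I_n * 'I_n) | r q.1.1 q.1.2 && r q.2.1 q.2.2]| =
  (#|[set a : 'I_m * 'I_m | r a.1 a.2]| * #|[set b : 'I_n * 'I_n | r b.1 b.2]|)%N.
Proof. by rewrite -cardsX; apply: eq_card => q; rewrite !inE. Qed.

End Counting.

(** * Quadratic forms vanishing on the slices *)

Section Forms.
Variable RR : realType.

Section Spanning.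
Variables (m n K : nat) (G : 'M[RR]_(m, K)) (H : 'M[RR]_(n, K)).
Hypothesis rankGH : \rank (G ⊙ G ⊙ H ⊙ H) =
  (m * (m + 1) %/ 2 * (n * (n + 1) %/ 2))%N.

Let I := (('I_m * 'I_m) * ('I_n * 'I_n))%type.
Let y (q : I) k := G q.1.1 k * G q.1.2 k * (H q.2.1 k * H q.2.2 k).

Let srt p (a : 'I_p * 'I_p) := if (a.1 <= a.2)%N then a else (a.2, a.1).
Let srt2 (q : I) : I := (srt q.1, srt q.2).
Let D := [set q : I | (q.1.1 <= q.1.2)%N && (q.2.1 <= q.2.2)%N].

Let srtP p (a : 'I_p * 'I_p) : ((srt a).1 <= (srt a).2)%N.
Proof. by rewrite /srt; case: (leqP a.1 a.2) => // /ltnW. Qed.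

Let srt2D q : srt2 q \in D. Proof. by rewrite inE !srtP. Qed.

Let srt2_inv T (f : 'I_m -> 'I_m -> 'I_n -> 'I_n -> T) :
  (forall i i' j j', f i i' j j' = f i' i j j') ->
  (forall i i' j j', f i i' j j' = f i i' j' j) ->
  forall q, f (srt2 q).1.1 (srt2 q).1.2 (srt2 q).2.1 (srt2 q).2.2 =
            f q.1.1 q.1.2 q.2.1 q.2.2.
Proof.
move=> f1 f2 [[i i'] [j j']]; rewrite /srt2 /srt /=.
by case: (i <= i')%N; case: (j <= j')%N => //=; rewrite ?(f1 i') ?(f2 _ _ j').
Qed.

(** The columns of [G ⊙ G ⊙ H ⊙ H] lie in the space of tensors symmetric in
    both pairs of modes, whose dimension is the assumed rank; so they span it,
    and a tensor of that space orthogonal to all of them is zero. In matrix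
    terms, keeping one row per orbit of the symmetry leaves a matrix of the same
    rank, hence of full row rank. *)
Lemma bisym_orthogonal_eq0 (z : 'I_m -> 'I_m -> 'I_n -> 'I_n -> RR) :
  (forall i i' j j', z i i' j j' = z i' i j j') ->
  (forall i i' j j', z i i' j j' = z i i' j' j) ->
  (forall k, \sum_i \sum_i' \sum_j \sum_j'
     z i i' j j' * (G i k * G i' k * (H j k * H j' k)) = 0) ->
  forall i i' j j', z i i' j j' = 0.
Proof.
move=> z1 z2 z0 i i' j j'.
pose X : 'M[RR]_(#|D|, K) := \matrix_(o, k) y (enum_val o) k.
have ysrt q k : y (srt2 q) k = y q k.
  apply: (@srt2_inv _ (fun a a' b b' => G a k * G a' k * (H b k * H b' k))).
    by move=> *; rewrite (mulrC (G _ _)).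
  by move=> *; rewrite (mulrC (H _ _)).
pose rk q := enum_rank_in (srt2D q) (srt2 q).
have rkK q : enum_val (rk q) = srt2 q by rewrite enum_rankK_in.
have freeX : row_free X.
  rewrite /row_free eqn_leq rank_leq_row /=.
  apply: leq_trans (_ : \rank (G ⊙ G ⊙ H ⊙ H) <= _)%N.
    by rewrite rankGH -!card_leq_pairs -(card_pair_product _ _ leq).
  rewrite mxrankS //.
  apply/row_subP => l; case: (mxtens_indexP l) => l' b'.
  case: (mxtens_indexP l') => l'' b; case: (mxtens_indexP l'') => a a'.
  have -> : row (mxtens_index (mxtens_index (mxtens_index (a, a'), b), b'))
      (G ⊙ G ⊙ H ⊙ H) = row (rk ((a, a'), (b, b'))) X.
    apply/rowP => k; rewrite [RHS]mxE [RHS]mxE rkK ysrt /y /=.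
    rewrite mxE mxE kronvE mxE mxE kronvE mxE mxE kronvE !mxE.
    by ring.
  exact: row_sub.
pose zq (q : I) := z q.1.1 q.1.2 q.2.1 q.2.2.
have zsrt q : zq (srt2 q) = zq q by exact: srt2_inv.
pose u : 'rV[RR]_(#|D|) := \row_o \sum_(q | srt2 q == enum_val o) zq q.
have /(congr1 (mulmx^~ (pinvmx X))) : u *m X = 0.
  apply/rowP => k; rewrite mxE [RHS]mxE -[RHS](z0 k).
  under eq_bigr => o _ do rewrite !mxE mulr_suml.
  rewrite (exchange_big_dep xpredT) //=.
  transitivity (\sum_q zq q * y q k).
    apply: eq_bigr => q _; rewrite (big_pred1 (rk q)) ?rkK ?ysrt // => o.
    apply/eqP/eqP => [qo | ->]; last by rewrite rkK.
    by apply: enum_val_inj; rewrite rkK.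
  rewrite -(pair_big xpredT xpredT (fun a b => zq (a, b) * y (a, b) k)) /=.
  rewrite -(pair_big xpredT xpredT (fun a a' =>
    \sum_b zq ((a, a'), b) * y ((a, a'), b) k)) /=.
  apply: eq_bigr => a _; apply: eq_bigr => a' _.
  by rewrite -(pair_big xpredT xpredT (fun b b' =>
    zq ((a, a'), (b, b')) * y ((a, a'), (b, b')) k)).
rewrite mulmxKp // mul0mx => /rowP/(_ (rk ((i, i'), (j, j')))).
rewrite !mxE rkK => /eqP.
rewrite (eq_bigr (fun _ => z i i' j j')); last first.
  by move=> q /eqP qE; rewrite -zsrt qE zsrt.
rewrite sumr_const mulrn_eq0 => /orP[|/eqP //].
by move=> /eqP/card0_eq/(_ ((i, i'), (j, j'))); rewrite unfold_in !eqxx.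
Qed.

End Spanning.
Section Coordinates.
Variables m n : nat.
Implicit Types (c : 'cV[RR]_((n * m) * (n * m))) (F : 'M[RR]_(m, n)).

(** The coefficient of [Y i j * Y i' j'] in the quadratic form
    [Y |-> c^T *m (vec Y ⊠ vec Y)]. *)
Definition coef c i j i' j' :=
  c (mxtens_index (mxtens_index (j', i'), mxtens_index (j, i))) 0.

Lemma coef_inj c c' :
  (forall i j i' j', coef c i j i' j' = coef c' i j i' j') -> c = c'.
Proof.
move=> cc'; apply/colP => k; case: (mxtens_indexP k) => l' l.
by case: (mxtens_indexP l') => ? ?; case: (mxtens_indexP l) => ? ?; exact: cc'.
Qed.

Lemma sym2_coefP c :
  sym2 c = c <-> forall i j i' j', coef c i j i' j' = coef c i' j' i j.
Proof.
rewrite sym2P; split=> [cC * | cC k l]; first exact: cC.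
by case: (mxtens_indexP k) => j' i'; case: (mxtens_indexP l) => j i; exact: cC.
Qed.

Lemma pi_mx_coef c i i' j j' :
  pi_mx c (mxtens_index (i, i')) (mxtens_index (j, j')) =
  4^-1 * (coef c i j i' j' + coef c i j' i' j
          + coef c i' j i j' + coef c i' j' i j).
Proof. by rewrite mxE !mxtens_indexK. Qed.

Lemma quadratic_coef c (Y : 'M[RR]_(m, n)) :
  (c^T *m (vec Y ⊠ vec Y)) 0 0 =
  \sum_i \sum_i' \sum_j \sum_j' coef c i j i' j' * (Y i j * Y i' j').
Proof.
rewrite mxE sum_mxtens sum_mxtens exchange_big [RHS]exchange_big /=.
apply: eq_bigr => i' _; rewrite [RHS]exchange_big /=.
under eq_bigr => j' _ do rewrite sum_mxtens.
rewrite exchange_big /=; apply: eq_bigr => j _; rewrite exchange_big /=.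
apply: eq_bigr => i _; apply: eq_bigr => j' _.
by rewrite mxE kronvE !mxE !mxtens_indexK /= (mulrC (Y i' j')).
Qed.

(** A form only depends on its symmetric part. *)
Lemma sym2_quadratic k (v : 'cV[RR]_(k * k)) (w : 'cV[RR]_k) :
  (sym2 v)^T *m (w ⊠ w) = v^T *m (w ⊠ w).
Proof.
have E (u : 'cV[RR]_(k * k)) : (u^T *m (w ⊠ w)) 0 0 =
    \sum_i \sum_j u (mxtens_index (i, j)) 0 * (w i 0 * w j 0).
  rewrite mxE sum_mxtens; apply: eq_bigr => i _; apply: eq_bigr => j _.
  by rewrite mxE kronvE.
apply/matrixP => a b; rewrite !ord1 !E.
pose S := \sum_i \sum_j v (mxtens_index (i, j)) 0 * (w i 0 * w j 0).
have ST : \sum_i \sum_j v (mxtens_index (j, i)) 0 * (w i 0 * w j 0) = S.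
  rewrite exchange_big; apply: eq_bigr => i _; apply: eq_bigr => j _.
  by rewrite (mulrC (w j 0)).
transitivity (2^-1 * (S + S)); last by rewrite /S; field.
rewrite -[in X in _ + X]ST /S -big_split mulr_sumr; apply: eq_bigr => i _.
rewrite -big_split mulr_sumr; apply: eq_bigr => j _.
by rewrite sym2E /=; ring.
Qed.

(** A slice of the tensor without its outer factors [A] and [B]. *)
Definition core_slice K F (G : 'M[RR]_(m, K)) (H : 'M[RR]_(n, K)) k :
    'M[RR]_(m, n) :=
  diag_mx (col k G)^T *m F *m diag_mx (col k H)^T.

(** On the core slices [Y i j = g i * F i j * h j] the products [Y i j * Y i' j']
    and [Y i j' * Y i' j] differ by a constant factor. When the columns [g], [h]
    are generic enough, no other relation holds between these products, and a
    symmetric [c] vanishes on the slices iff it satisfies the following. *)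
Definition swap_relation F c := forall i j i' j',
  coef c i j i' j' * (F i j * F i' j') + coef c i j' i' j * (F i j' * F i' j) = 0.

(** Collecting the terms with the same [{i, i'}] and [{j, j'}], the value of [c]
    on a core slice is the inner product of a tensor symmetric in both pairs with
    a column of [G ⊙ G ⊙ H ⊙ H]; its vanishing on every column is the vanishing
    of that tensor. *)
Lemma swap_relationP K F (G : 'M[RR]_(m, K)) (H : 'M[RR]_(n, K)) c :
  \rank (G ⊙ G ⊙ H ⊙ H) = (m * (m + 1) %/ 2 * (n * (n + 1) %/ 2))%N ->
  sym2 c = c ->
  (forall k, c^T *m (vec (core_slice F G H k) ⊠ vec (core_slice F G H k)) = 0)
  <-> swap_relation F c.
Proof.
move=> rankGH /sym2_coefP cC; pose Y := core_slice F G H.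
have YE k i j : Y k i j = G i k * F i j * H j k.
  by rewrite /Y /core_slice mul_diag_mx mul_mx_diag !mxE.
pose w i i' j j' := coef c i j i' j' * (F i j * F i' j').
pose y k i i' j j' := G i k * G i' k * (H j k * H j' k).
pose z i i' j j' := w i i' j j' + w i i' j' j.
have wC i i' j j' : w i i' j j' = w i' i j' j by rewrite /w cC; ring.
have doubleE k : (c^T *m (vec (Y k) ⊠ vec (Y k))) 0 0 =
    2^-1 * \sum_i \sum_i' \sum_j \sum_j' z i i' j j' * y k i i' j j'.
  rewrite quadratic_coef mulr_sumr; apply: eq_bigr => i _.
  rewrite mulr_sumr; apply: eq_bigr => i' _.
  pose S := \sum_j \sum_j' w i i' j j' * y k i i' j j'.
  have ST : \sum_j \sum_j' w i i' j' j * y k i i' j j' = S.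
    rewrite exchange_big; apply: eq_bigr => j _; apply: eq_bigr => j' _.
    by rewrite /y (mulrC (H j' k)).
  transitivity S.
    apply: eq_bigr => j _; apply: eq_bigr => j' _.
    by rewrite !YE /w /y; ring.
  transitivity (2^-1 * (S + S)); first by field.
  congr (_ * _); rewrite -[in X in _ + X]ST /S -big_split.
  apply: eq_bigr => j _; rewrite -big_split; apply: eq_bigr => j' _.
  by rewrite /z /=; ring.
split=> [c0 i j i' j' | c0 k].
  apply: (bisym_orthogonal_eq0 rankGH (z := z)) => [||k].
  - by move=> *; rewrite /z addrC; congr (_ + _); exact: wC.
  - by move=> *; rewrite /z addrC.
  have := doubleE k; rewrite c0 mxE => /esym/eqP; rewrite mulf_eq0.
  by rewrite invr_eq0 pnatr_eq0 => /eqP.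
apply/matrixP => a b; rewrite !ord1 -/(Y k) doubleE mxE big1 ?mulr0 // => i _.
rewrite big1 // => i' _; rewrite big1 // => j _; rewrite big1 // => j' _.
by rewrite /z /w c0 mul0r.
Qed.

End Coordinates.

End Forms.

(** * The space of forms vanishing on the slices *)

Section SliceForms.
Variables (RR : realType) (m n : nat) (F : 'M[RR]_(m, n)).
Hypothesis F0 : forall i j, F i j != 0.
Implicit Types (c : 'cV[RR]_((n * m) * (n * m))).

Definition slice_form c := sym2 c = c /\ swap_relation F c.

(** The general solution of the swap relations: [t] is free but for its two
    antisymmetries. *)
Definition alternating_form (t : 'I_m -> 'I_m -> 'I_n -> 'I_n -> RR) :
    'cV[RR]_((n * m) * (n * m)) :=
  \col_k let: (j', i') := mxtens_unindex (mxtens_unindex k).1 in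
         let: (j, i) := mxtens_unindex (mxtens_unindex k).2 in
         t i i' j j' * (F i j' * F i' j).

Lemma coef_alternating t i j i' j' :
  coef (alternating_form t) i j i' j' = t i i' j j' * (F i j' * F i' j).
Proof. by rewrite /coef mxE !mxtens_indexK. Qed.

Lemma alternating_slice_form t :
  (forall i i' j j', t i i' j j' = - t i' i j j') ->
  (forall i i' j j', t i i' j j' = - t i i' j' j) ->
  slice_form (alternating_form t).
Proof.
move=> t1 t2; split.
  by apply/sym2_coefP => i j i' j'; rewrite !coef_alternating t1 t2; ring.
by move=> i j i' j'; rewrite !coef_alternating (t2 i i' j'); ring.
Qed.

(** When the minor at [(i, i', j, j')] vanishes, the swap relation says that
    the two coefficients averaged by [pi_mx] cancel. *)
Lemma pi_slice_form c : slice_form c -> minor_supported F (pi_mx c).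
Proof.
move=> [/sym2_coefP cC cF] i i' j j' /=; rewrite !pi_mx_coef.
split; [by congr (_ * _); ring | by congr (_ * _); ring |].
move=> /eqP; rewrite subr_eq0 => /eqP FE.
have /eqP := cF i j i' j'; rewrite FE -mulrDl !mulf_eq0 !(negPf (F0 _ _)) !orbF.
move=> /eqP cc0; rewrite (cC i' j) (cC i' j') cc0 add0r.
by rewrite [_ + coef _ i j _ _]addrC cc0 mulr0.
Qed.

(** On [alternating_form t], [pi_mx] multiplies [t] by [-1/2] times the minors,
    so [t] is obtained by division where the minor is nonzero. *)
Lemma pi_slice_form_onto Q :
  minor_supported F Q -> exists2 c, slice_form c & pi_mx c = Q.
Proof.
move=> FQ; pose t i i' j j' : RR :=
  - 2 * Q (mxtens_index (i, i')) (mxtens_index (j, j')) / minor2 F i i' j j'.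
have t1 i i' j j' : t i i' j j' = - t i' i j j'.
  rewrite /t; have [/= -> _ _] := FQ i i' j j'.
  have -> : minor2 F i i' j j' = - minor2 F i' i j j' by rewrite /minor2; ring.
  by rewrite invrN mulrN.
have t2 i i' j j' : t i i' j j' = - t i i' j' j.
  rewrite /t; have [/= _ -> _] := FQ i i' j j'.
  have -> : minor2 F i i' j j' = - minor2 F i i' j' j by rewrite /minor2; ring.
  by rewrite invrN mulrN.
exists (alternating_form t); first exact: alternating_slice_form.
apply/matrixP => k l; case: (mxtens_indexP k) => i i'.
case: (mxtens_indexP l) => j j'; rewrite pi_mx_coef !coef_alternating.
rewrite (t2 i i' j' j) (t1 i' i j j') (t2 i' i j' j) (t1 i' i j j').
transitivity (- 2^-1 * (t i i' j j' * minor2 F i i' j j')).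
  by rewrite /minor2; field.
rewrite /t; have [/eqP m0 | m0] := boolP (minor2 F i i' j j' == 0).
  by have [/= _ _ ->] := FQ i i' j j'; rewrite ?(mulr0, mul0r).
by rewrite divfK //; field.
Qed.

Let D :=
  [set q : ('I_m * 'I_m) * ('I_n * 'I_n) | (q.1.1 < q.1.2)%N && (q.2.1 < q.2.2)%N].

(** The relations with [i = i'] or [j = j'] make those coefficients vanish, the
    others determine the case [j > j'] from [j < j'], and the symmetry of [c]
    determines the case [i > i'] from [i < i']. *)
Lemma slice_form_eq0 c : slice_form c ->
  (forall q, q \in D -> coef c q.1.1 q.2.1 q.1.2 q.2.2 = 0) -> c = 0.
Proof.
move=> [/sym2_coefP cC cF] c0; apply: coef_inj => i j i' j'.
rewrite [RHS]mxE.
have swap a b a' b' : coef c a b' a' b = 0 -> coef c a b a' b' = 0.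
  move=> c1; have /eqP := cF a b a' b'; rewrite c1 mul0r addr0 !mulf_eq0.
  by rewrite !(negPf (F0 _ _)) !orbF => /eqP.
have double (x y z : RR) : z != 0 -> x * z + y * z = 0 -> x = y -> x = 0.
  move=> z0 /[swap] <-; rewrite -mulrDl -mulr2n => /eqP.
  by rewrite mulf_eq0 mulrn_eq0 (negPf z0) orbF => /eqP.
have same a b b' : coef c a b a b' = 0.
  apply: (double _ (coef c a b' a b) (F a b * F a b')); last exact: cC.
    by rewrite mulf_neq0.
  by rewrite -[RHS](cF a b a b') [F a b' * _]mulrC.
have same' a a' b : coef c a b a' b = 0.
  apply: (double _ (coef c a b a' b) (F a b * F a' b)) => //.
  by rewrite mulf_neq0.
have lt_eq0 (a : 'I_m) (b : 'I_n) (a' : 'I_m) (b' : 'I_n) :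
    (a < a')%N -> coef c a b a' b' = 0.
  move=> aa'; case: (ltngtP b b') => [bb' | b'b | /val_inj <-] //.
    by apply: (c0 ((a, a'), (b, b'))); rewrite inE /= aa' bb'.
  by apply/swap/(c0 ((a, a'), (b', b))); rewrite inE /= aa' b'b.
case: (ltngtP i i') => [ii' | i'i | /val_inj <-]; [exact: lt_eq0 | | exact: same].
by rewrite cC lt_eq0.
Qed.

(* As a function of [b], this is the antisymmetric extension of the indicator
   of the increasing pair [a]. *)
Let alt p (a b : 'I_p * 'I_p) : RR := (b == a)%:R - ((b.2, b.1) == a)%:R.

Lemma slice_form_onto (u : ('I_m * 'I_m) * ('I_n * 'I_n) -> RR) :
  exists2 c, slice_form c &
    forall q, q \in D -> coef c q.1.1 q.2.1 q.1.2 q.2.2 = u q.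
Proof.
pose t i i' j j' := \sum_(q in D) u q / (F q.1.1 q.2.2 * F q.1.2 q.2.1)
  * (alt q.1 (i, i') * alt q.2 (j, j')).
have altN p a (b b' : 'I_p) : alt a (b, b') = - alt a (b', b).
  by rewrite /alt opprB.
exists (alternating_form t).
  apply: alternating_slice_form => i i' j j'; rewrite /t -sumrN;
    apply: eq_bigr => q _.
    by rewrite (altN _ q.1 i); ring.
  by rewrite (altN _ q.2 j); ring.
have altE p (a b : 'I_p * 'I_p) : (a.1 < a.2)%N -> (b.1 < b.2)%N ->
    alt a b = (b == a)%:R.
  case: a b => [a a'] [b b'] /= aa' bb'; rewrite /alt /=.
  suff /negPf -> : (b', b) != (a, a') by rewrite subr0.
  apply/negP => /eqP[Eb' Eb]; move: bb'; rewrite Eb' Eb.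
  by rewrite ltnNge (ltnW aa').
move=> [[i i'] [j j']] qD; rewrite coef_alternating /t (bigD1 _ qD) /=.
move: (qD); rewrite inE /= => /andP[ii' jj'].
rewrite big1 ?addr0 => [|[a b] /andP[abD nq]] /=.
  by rewrite !altE // !eqxx !mulr1 divfK // mulf_neq0.
have /[!inE]/andP[/= aa' bb'] : (a, b) \in D by [].
rewrite !altE // -natrM mulnb.
by rewrite -[_ && _]/((_, _) == (_, _)) eq_sym (negPf nq) mulr0.
Qed.

(** The coefficients at [i < i'], [j < j'] are free coordinates on the slice
    forms: they determine a form and take arbitrary values. *)
Lemma dim_slice_forms (L : 'M[RR]_((n * m) * (n * m)))
    (V : {vspace 'cV[RR]_((n * m) * (n * m))}) :
  L \in unitmx -> (forall p, p \in V <-> slice_form (L *m p)) ->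
  \dim V = ('C(m, 2) * 'C(n, 2))%N.
Proof.
move=> uL VE.
pose pos (o : 'I_#|D|) := let q := enum_val o in
  mxtens_index (mxtens_index (q.2.2, q.1.2), mxtens_index (q.2.1, q.1.1)).
pose g : 'Hom('cV[RR]_((n * m) * (n * m)), 'cV[RR]_#|D|) :=
  linfun (mulmx (rowsub pos L)).
have gE p o : g p o 0 = let q := enum_val o in
    coef (L *m p) q.1.1 q.2.1 q.1.2 q.2.2.
  by rewrite lfunE /= mul_rowsub_mx mxE.
rewrite -(@limg_dim_eq _ _ _ g); last first.
  apply/eqP; rewrite -subv0; apply/subvP => p; rewrite memv_cap memv_ker memv0.
  move=> /andP[/VE pV /eqP gp]; apply/eqP/(can_inj (mulKmx uL)).
  rewrite mulmx0; apply: slice_form_eq0 pV _ => q qD.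
  by have := gE p (enum_rank_in qD q); rewrite gp mxE enum_rankK_in.
have -> : (g @: V)%VS = fullv.
  apply/eqP; rewrite eqEsubv subvf; apply/subvP => u _.
  have [c cF cu] := slice_form_onto (fun q => \sum_(o | enum_val o == q) u o 0).
  apply/memv_imgP; exists (invmx L *m c); first by apply/VE; rewrite mulKVmx.
  apply/colP => o; rewrite gE mulKVmx //= cu ?enum_valP // (big_pred1 o) // => o'.
  exact: (inj_eq enum_val_inj).
rewrite dimvf /dim /= muln1 (card_pair_product _ _ ltn).
by rewrite !card_ltn_pairs.
Qed.

End SliceForms.
(** * Change of coordinates by the factors *)

Section Factors.
Variables (RR : realType) (R S K : nat).
Variables (A : 'M[RR]_R) (B : 'M[RR]_S) (F : 'M[RR]_(R, S)).
Variables (G : 'M[RR]_(R, K)) (H : 'M[RR]_(S, K)).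
Hypotheses (uA : A \in unitmx) (uB : B \in unitmx).

Let L : 'M[RR]_((S * R) * (S * R)) := ((B *t A) *t (B *t A))^T.

Lemma factor_unitmx : L \in unitmx.
Proof. by rewrite unitmx_tr !tens_unitmx. Qed.

(** The form [p] in the variable [X = A *m Y *m B^T] is the form [L *m p]
    in [Y]; this change of coordinates commutes with [pi_mx], which is checked
    on rank-one tensors. *)
Lemma pi_mx_factor p : pi_mx (L *m p) = (A *t A)^T *m pi_mx p *m (B *t B).
Proof.
have uAA : (A *t A)^T \in unitmx by rewrite unitmx_tr tens_unitmx.
have uBB := tens_unitmx uB uB.
pose f : {linear 'cV[RR]_((S * R) * (S * R)) -> 'M[RR]_(R * R, S * S)} :=
  mulmxr (invmx (B *t B)) \o (mulmx (invmx (A *t A)^T)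
    \o (@pi_mx RR R S \o mulmx L)).
suff fE : f =1 @pi_mx RR R S.
  by rewrite -(fE p) /= !mulmxA mulmxV // mul1mx mulmxKV.
apply: pi_mx_unique => a b y z /=.
have -> : L *m vec_outer4 a b y z =
    vec_outer4 (A^T *m a) (B^T *m b) (A^T *m y) (B^T *m z).
  by rewrite /L !trmx_tens /vec_outer4 !tens_kronv.
rewrite pi_mx_outer -!tens_kronv -!mulmxDr !scalemxAr trmx_mul !trmx_tens !trmxK.
by rewrite !mulmxA mulmxK // -[(A^T *t A^T)]trmx_tens mulVmx // mul1mx.
Qed.

Lemma mem_sigma2_left_ker_Phi p :
  \rank (G ⊙ G ⊙ H ⊙ H) = (R * (R + 1) %/ 2 * (S * (S + 1) %/ 2))%N ->
  p \in (sigma2 RR (S * R) @: left_ker (Phi (PT2D A B F G H)))%VS <->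
  slice_form F (L *m p).
Proof.
move=> rankGH.
pose Y := core_slice F G H.
have vecT k : vec (PT2D A B F G H k) = (B *t A) *m vec (Y k).
  by rewrite -vec_mul /PT2D /Y /core_slice !mulmxA.
have kerE p0 : p0 \in left_ker (Phi (PT2D A B F G H)) <->
    forall k, (L *m p0)^T *m (vec (Y k) ⊠ vec (Y k)) = 0.
  have colPhi k : col k (p0^T *m Phi (PT2D A B F G H)) =
      (L *m p0)^T *m (vec (Y k) ⊠ vec (Y k)).
    rewrite /L trmx_mul trmxK -mulmxA tens_kronv -vecT.
    rewrite !colE -mulmxA; congr (_ *m _); rewrite -colE.
    by apply/colP => l; rewrite [LHS]mxE [LHS]mxE.
  rewrite mem_left_ker; split=> [/eqP p0k k | p0k]; first by rewrite -colPhi p0k col0.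
  apply/eqP/matrixP => i k; have /colP/(_ i) := colPhi k.
  by rewrite p0k !mxE.
have symL q : sym2 (L *m q) = L *m sym2 q by rewrite /L trmx_tens sym2_tens.
split=> [/memv_imgP[q /kerE qk ->] | [symp pF]].
  rewrite lfunE /= -symL; split; first exact: sym2_id.
  by apply/(swap_relationP F rankGH (sym2_id _)) => k; rewrite sym2_quadratic qk.
apply/memv_imgP; exists p; first exact/kerE/(swap_relationP F rankGH symp).
apply: (can_inj (mulKmx factor_unitmx)).
by rewrite lfunE /= -symL symp.
Qed.

End Factors.

Theorem theorem5p4 (RR : realType) (R S K : nat) (T : tensor RR R S K)
    (A : 'M[RR]_R) (B : 'M[RR]_S) (F : 'M[RR]_(R, S))
    (G : 'M[RR]_(R, K)) (H : 'M[RR]_(S, K)) :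
  (2 <= R)%N -> (2 <= S)%N ->
  T = PT2D A B F G H ->
  \rank A = R -> \rank B = S ->
  (forall i j, F i j != 0) ->
  \rank (G ⊙ G ⊙ H ⊙ H) = ((R * (R + 1)) %/ 2 * ((S * (S + 1)) %/ 2))%N ->
  let M := ('C(R, 2) * 'C(S, 2))%N in
  let V := (sigma2 RR (S * R) @: left_ker (Phi T))%VS in
  \dim V = M /\
  forall p : M.-tuple 'cV[RR]_((S * R) * (S * R)), basis_of V p ->
    let P (k : 'I_M) := pi_mx (tnth p k) in
    let PA := \mxrow_(k < M) P k in
    let PB := \mxrow_(k < M) (P k)^T in
    let VA := (sigma2 RR R @: left_ker PA)%VS in
    let VB := (sigma2 RR S @: left_ker PB)%VS in
    [/\ \dim VA = R <-> (2 <= krank F^T)%N,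
        (2 <= krank F^T)%N ->
          VA = <<[seq col k A ⊠ col k A | k : 'I_R]>>%VS /\
          VA = range_mx (A ⊙ A),
        \dim VB = S <-> (2 <= krank F)%N
      & (2 <= krank F)%N ->
          VB = <<[seq col k B ⊠ col k B | k : 'I_S]>>%VS /\
          VB = range_mx (B ⊙ B)].

Proof.
move=> R2 S2 -> rankA rankB F0 rankGH M V.
have uA : A \in unitmx by rewrite -row_free_unit /row_free rankA.
have uB : B \in unitmx by rewrite -row_free_unit /row_free rankB.
have R0 := ltnW R2; have S0 := ltnW S2.
pose L := ((B *t A) *t (B *t A))^T.
have uL : L \in unitmx := factor_unitmx uA uB.
have VE p : p \in V <-> slice_form F (L *m p).
  exact: mem_sigma2_left_ker_Phi.
split=> [|p pV P PA PB VA VB]; first exact: (dim_slice_forms F0 uL VE).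
have P_supp k : minor_supported F ((A *t A)^T *m P k *m (B *t B)).
  rewrite -pi_mx_factor //; apply: pi_slice_form => //.
  by apply/VE/(basis_mem pV)/mem_tnth.
have P_full Q : minor_supported F Q ->
    exists x : 'I_M -> RR, (A *t A)^T *m (\sum_k x k *: P k) *m (B *t B) = Q.
  move=> /pi_slice_form_onto[c cF <-].
  have cV : invmx L *m c \in V by apply/VE; rewrite mulKVmx.
  exists (fun k => coord p k (invmx L *m c)).
  have -> : \sum_k coord p k (invmx L *m c) *: P k = pi_mx (invmx L *m c).
    rewrite [in RHS](coord_basis pV cV) linear_sum; apply: eq_bigr => k _.
    by rewrite linearZ /P (tnth_nth 0).
  by rewrite -pi_mx_factor // mulKVmx.
have trE (N : 'M_(R * R, S * S)) :
    (B *t B)^T *m N^T *m (A *t A) = ((A *t A)^T *m N *m (B *t B))^T.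
  by rewrite !trmx_mul trmxK mulmxA.
have PT_supp k : minor_supported F^T ((B *t B)^T *m (P k)^T *m (A *t A)).
  by rewrite trE; exact: minor_supported_tr.
have PT_full Q : minor_supported F^T Q ->
    exists x : 'I_M -> RR, (B *t B)^T *m (\sum_k x k *: (P k)^T) *m (A *t A) = Q.
  move=> /minor_supported_tr; rewrite trmxK => /P_full[x xQ]; exists x.
  apply: trmx_inj; rewrite -xQ -[RHS]trmxK -trE; congr (_ *m _ *m _)^T.
  by rewrite linear_sum; apply: eq_bigr => k _; rewrite linearZ.
have F0T i j : F^T i j != 0 by rewrite mxE.
have krA := krank_tr_ge2 R2 S0 F0.
have krB := krank_tr_ge2 S2 R0 F0T; rewrite trmxK in krB.
split.
- by rewrite krA; exact: (dim_sigma2_left_ker uA uB P_supp P_full).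
- by rewrite krA span_khatri_rao; split;
    exact: (sigma2_left_kerE uA uB P_supp P_full).
- by rewrite krB; exact: (dim_sigma2_left_ker uB uA PT_supp PT_full).
- by rewrite krB span_khatri_rao; split;
    exact: (sigma2_left_kerE uB uA PT_supp PT_full).
Qed.
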